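(* Let $\tau>0$, $T=4\tau$ and $N=\sum_{\kappa=0}^{L-1}n_\kappa n_{\kappa+1}$. The full reading procedure (described in the context), which has finite total duration $$T_{\mathrm{tot}}=T\sum_{\kappa=0}^{L-1}n_\kappa n_{\kappa+1},$$ solves the reading problem. That is, with the input $P^0:[0,T_{\mathrm{tot}}]\to\mathbb{R}^{n_0}$ and the switch signals $S^\ell:[0,T_{\mathrm{tot}}]\to\{0,1\}^{n_\ell\times n_{\ell-1}}$, $\ell\in[L]$, produced by the procedure, for any initial conditions $\varphi_0^1,\dots,\varphi_0^L$ with $\varphi_0^\ell\in\mathbb{R}^{n_\ell\times n_{\ell-1}}$ (and resulting voltage signals $P^{\ell-1}$), the following two properties hold for all $\ell\in[L]$: 1. for every $\bar\varphi_0^\ell\in\mathbb{R}^{n_\ell\times n_{\ell-1}}$: if $\bar J^\ell(t;\varphi^\ell_0,P^{\ell-1})=\bar J^\ell(t;\bar\varphi^\ell_0,P^{\ell-1})$ for all $t\in[0,T_{\mathrm{tot}}]$, then $W(\varphi_0^\ell)=W(\bar\varphi_0^\ell)$; 2. $\varphi^\ell(T_{\mathrm{tot}};\varphi_0^\ell,P^{\ell-1})=\varphi_0^\ell$.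
   Context: Notation: $[n]=\{1,\dots,n\}$; $\mathbb 1_m\in\mathbb{R}^m$ is the all-ones column vector; $\odot$ is the entrywise (Hadamard) product. $L\ge 1$ and $n_0,\dots,n_L$ are positive integers. Activation function: $\sigma:\mathbb{R}\to\mathbb{R}$ is continuously differentiable, odd, strictly monotone (meaning $(\sigma(x)-\sigma(y))(x-y)>0$ for all $x\ne y$) and $\eta$-Lipschitz continuous for some $\eta>0$. $\sigma^\ell:\mathbb{R}^{n_\ell}\to\mathbb{R}^{n_\ell}$ is the entrywise application of $\sigma$. Memristors: $g:\mathbb{R}\to\mathbb{R}$ is continuously differentiable with $W(\varphi):=\frac{dg(\varphi)}{d\varphi}>0$ for all $\varphi\in\mathbb{R}$; $W$ is strictly monotone (meaning $(W(x)-W(y))(x-y)>0$ for all $x\ne y$), $\beta$-Lipschitz continuous for some $\beta>0$, and there are constants $W_{\max}\ge W_{\min}>0$ with $W_{\max}\ge W(x)\ge W_{\min}$ for all $x\in\mathbb{R}$. For a matrix $\varphi$, $W(\varphi)$ is the matrix obtained by applying $W$ entrywise. Circuit equations: with flux matrices $\varphi^\ell(t)\in\mathbb{R}^{n_\ell\times n_{\ell-1}}$, switch matrices $S^\ell(t)\in\{0,1\}^{n_\ell\times n_{\ell-1}}$ and input $P^0(t)\in\mathbb{R}^{n_0}$, $$\tfrac{d}{dt}\varphi^\ell=S^\ell\odot(\mathbb 1_{n_\ell}(P^{\ell-1})^\top),\quad \bar J^\ell=(W(\varphi^\ell)\odot S^\ell)P^{\ell-1},\quad P^\ell=\sigma^\ell(\bar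 J^\ell)\qquad(\ell\in[L]).$$ The differential equations are understood in integrated form since signals may be discontinuous; the relations for $\bar J^\ell,P^\ell$ hold pointwise in $t$. For given switch signals, $\varphi^\ell(t;\varphi_0^\ell,P^{\ell-1})$ and $\bar J^\ell(t;\varphi_0^\ell,P^{\ell-1})$ denote the flux and current of layer $\ell$ at time $t$ when its initial flux is $\varphi_0^\ell$ and its input voltage signal is $P^{\ell-1}$. Path: a path to the $(k,j)$-th memristor in layer $\ell$ is a tuple $\gamma=(\gamma_0,\dots,\gamma_\ell)$ with $\gamma_\kappa\in[n_\kappa]$, $\gamma_{\ell-1}=j$, $\gamma_\ell=k$. Switch settings corresponding to $\gamma$: for $\kappa\in[\ell]$, $S^\kappa_{ab}=1$ if $a=\gamma_\kappa$ and $b=\gamma_{\kappa-1}$, and $S^\kappa_{ab}=0$ otherwise; if $\ell<L$, $S^{\ell+1}=0$, and $S^\kappa$ is arbitrary for $\kappa\in\{\ell+2,\dots,L\}$. Block signal: for $\tau>0$, $Q(t)=0$ for $t<-2\tau$; $Q(t)=-1$ for $t\in[-2\tau,-\tau)$; $Q(t)=1$ for $t\in[-\tau,\tau]$; $Q(t)=-1$ for $t\in(\tau,2\tau]$; $Q(t)=0$ for $t>2\tau$. Full reading procedure: enumerate all memristors $(\ell,k,j)$, $\ell\in[L]$, $k\in[n_\ell]$, $j\in[n_{\ell-1}]$, in the order of nested loops $\ell=1,\dots,L$; $j=1,\dots,n_{\ell-1}$; $k=1,\dots,n_\ell$, and assign to the $m$-th one ($m\in[N]$) the time window $[(m-1)T,mT)$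 (the last window being closed), with $T=4\tau$. In the window of $(\ell,k,j)$, fix any path $\gamma$ to the $(k,j)$-th memristor in layer $\ell$, use the switch settings corresponding to $\gamma$, and apply $P^0_{\gamma_0}(t)=Q\bigl(t-(m-1)T-\tfrac T2\bigr)$; the components $P^0_b$ with $b\ne\gamma_0$ are not prescribed (all switches in those columns of layer 1 are open). *)

(* Defs.v *)
From mathcomp Require Import all_boot all_order all_algebra.
From mathcomp Require Import all_classical all_reals all_analysis.
Set Implicit Arguments.
Unset Strict Implicit.
Unset Printing Implicit Defensive.
Import Order.TTheory GRing.Theory Num.Theory.
Import numFieldNormedType.Exports.
Local Open Scope classical_set_scope.
Local Open Scope ring_scope.

Definition strictly_monotone (R : realType) (f : R -> R) : Prop :=
  forall x y, x != y -> 0 < (f x - f y) * (x - y).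

Definition continuously_differentiable (R : realType) (f : R -> R) : Prop :=
  (forall x, derivable f x 1) /\ continuous (derive1 f).

Definition activation_function (R : realType) (sigma : R -> R) : Prop :=
  [/\ continuously_differentiable sigma,
      (forall x, sigma (- x) = - sigma x),
      strictly_monotone sigma &
      exists2 eta : R, 0 < eta & eta.-lipschitz sigma].

(* The memductance W of the memristor is the derivative [derive1 g]. *)
Definition memristor_characteristic (R : realType) (g : R -> R) : Prop :=
  [/\ continuously_differentiable g,
      (forall x, 0 < derive1 g x),
      strictly_monotone (derive1 g),
      (exists2 beta : R, 0 < beta & beta.-lipschitz (derive1 g)) &
      exists Wmin Wmax : R, [/\ 0 < Wmin, Wmin <= Wmax &
        forall x, Wmin <= derive1 g x <= Wmax]].

Definition hadamard (R : realType) (m p : nat) (A B : 'M[R]_(m, p)) :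
    'M[R]_(m, p) :=
  map2_mx *%R A B.

Definition switch_mx (R : realType) (m p : nat) (S : 'M[bool]_(m, p)) :
    'M[R]_(m, p) :=
  map_mx (fun s : bool => s%:R) S.

Section Layer.
Variables (R : realType) (m p : nat).
Variables (S : R -> 'M[bool]_(m, p)) (phi0 : 'M[R]_(m, p)) (P : R -> 'cV[R]_p).

Definition flux_rate (t : R) : 'M[R]_(m, p) :=
  hadamard (switch_mx R (S t)) (const_mx 1 *m (P t)^T).

(* Integrated form of the flux equation, from the initial time 0.  The rate
   depends on neither the flux nor [phi0], so this is an explicit formula.
   Voltage components that reach only open switches contribute 0 and hence
   need no regularity. *)
Definition flux (t : R) : 'M[R]_(m, p) :=
  \matrix_(a, b)
    (phi0 a b + \int[lebesgue_measure]_(s in `[0, t]) flux_rate s a b).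

Definition current (W : R -> R) (t : R) : 'cV[R]_m :=
  hadamard (map_mx W (flux t)) (switch_mx R (S t)) *m P t.

End Layer.

(* Layers are numbered from 0: layer [l] here has [n l] inputs and [n l.+1]
   outputs and is layer l + 1 in one-based numbering.  Families are indexed by
   all of nat, but only the layers [l < L] of a network of depth [L] are used.
   Signals are functions on R of which only the values on the time interval
   under consideration matter.  [voltage l] is the signal P^l. *)
Fixpoint voltage (R : realType) (n : nat -> nat) (sigma W : R -> R)
    (P0 : R -> 'cV[R]_(n 0%N)) (S : forall l, R -> 'M[bool]_(n l.+1, n l))
    (phi0 : forall l, 'M[R]_(n l.+1, n l)) (l : nat) : R -> 'cV[R]_(n l) :=
  match l with
  | 0 => P0
  | l'.+1 => fun t =>
      map_mx sigma
        (current (S l') (phi0 l') (voltage sigma W P0 S phi0 l') W t)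
  end.

Definition solves_reading_problem (R : realType) (L : nat) (n : nat -> nat)
    (sigma W : R -> R) (Ttot : R) (P0 : R -> 'cV[R]_(n 0%N))
    (S : forall l, R -> 'M[bool]_(n l.+1, n l)) : Prop :=
  forall (phi0 : forall l, 'M[R]_(n l.+1, n l)) (l : nat), (l < L)%N ->
    let P := voltage sigma W P0 S phi0 l in
    (forall phi0bar : 'M[R]_(n l.+1, n l),
       (forall t, 0 <= t <= Ttot ->
          current (S l) (phi0 l) P W t = current (S l) phi0bar P W t) ->
       map_mx W (phi0 l) = map_mx W phi0bar) /\
    flux (S l) (phi0 l) P Ttot = phi0 l.

(* Node indices are zero-based as well; only [gamma 0], ..., [gamma l.+1]
   matter. *)
Definition is_path (n : nat -> nat) (l k j : nat) (gamma : nat -> nat) : Prop :=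
  [/\ forall i, (i <= l.+1)%N -> (gamma i < n i)%N,
      gamma l = j & gamma l.+1 = k].

(* Switches in the layers beyond [l.+1] are left unconstrained. *)
Definition path_switches (n : nat -> nat) (L l : nat) (gamma : nat -> nat)
    (S : forall i, 'M[bool]_(n i.+1, n i)) : Prop :=
  (forall i, (i <= l)%N -> forall (a : 'I_(n i.+1)) (b : 'I_(n i)),
     S i a b = (a == gamma i.+1 :> nat) && (b == gamma i :> nat)) /\
  ((l.+1 < L)%N -> S l.+1 = const_mx false).

Definition block_signal (R : realType) (tau t : R) : R :=
  if t < - (2 * tau) then 0
  else if t < - tau then -1
  else if t <= tau then 1
  else if t <= 2 * tau then -1
  else 0.

(* The triples (l, k, j), with l in the outer, j in the middle and k in the
   inner loop. *)
Definition memristors (L : nat) (n : nat -> nat) : seq (nat * nat * nat) :=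
  flatten [seq [seq (l, k, j) | j <- iota 0 (n l), k <- iota 0 (n l.+1)]
          | l <- iota 0 L].

Definition reading_duration (R : realType) (L : nat) (n : nat -> nat)
    (tau : R) : R :=
  (size (memristors L n))%:R * (4 * tau).

(* With T = 4 tau, the window of the m-th memristor, m counted from 0, is
   [mT, (m+1)T[, closed for the last one. *)
Definition in_window (R : realType) (L : nat) (n : nat -> nat) (tau : R)
    (m : nat) (t : R) : Prop :=
  (m%:R * (4 * tau) <= t < m.+1%:R * (4 * tau)) \/
  (m.+1 = size (memristors L n) /\ t = m.+1%:R * (4 * tau)).

(* A path is chosen once for each window.  The input components off the path
   are not prescribed. *)
Definition full_reading_procedure (R : realType) (L : nat) (n : nat -> nat)
    (tau : R) (P0 : R -> 'cV[R]_(n 0%N))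
    (S : forall l, R -> 'M[bool]_(n l.+1, n l)) : Prop :=
  forall m l k j : nat, onth (memristors L n) m = Some (l, k, j) ->
  exists2 gamma : nat -> nat, is_path n l k j gamma &
    forall t, in_window L n tau m t ->
      path_switches L l gamma (fun i => S i t) /\
      (forall b : 'I_(n 0%N), b = gamma 0%N :> nat ->
         P0 t b 0 = block_signal tau (t - m%:R * (4 * tau) - 4 * tau / 2)).

(* Main.v *)
Require Import Defs.
From mathcomp Require Import all_boot all_order all_algebra.
From mathcomp Require Import all_classical all_reals all_analysis.
From mathcomp Require Import measurable_realfun lra.
Import Order.TTheory GRing.Theory Num.Theory.
Import numFieldNormedType.Exports.
Local Open Scope classical_set_scope.
Local Open Scope ring_scope.

Set Implicit Arguments.
Unset Strict Implicit.

(** Why the reading procedure works.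

    During the window of a memristor only one chain of memristors carries
    current, the one along the chosen path, and the input of that chain is a
    square wave Q with values 1 and -1.  Write u for the running integral of Q
    since the beginning of the window.  The key observation is that layer after
    layer the fluxes are functions of u alone: on the path, the voltage has the
    form P = Q * h(u) with h continuous and h 0 != 0.  This form is inherited
    by the next layer ([on_path_voltage]).  If G is the primitive of h with
    G 0 = 0, then G(u) is a primitive of Q * h(u), so the flux is phi0 + G(u)
    ([probe_integral]); and since sigma is odd and Q is 1 or -1,
      sigma (W (phi0 + G(u)) * Q * h(u)) = Q * sigma (W (phi0 + G(u)) * h(u)).
    The block signal has integral 0 over a window, so u returns to 0 and every
    flux on the path returns to phi0 + G 0 = phi0.  Off the path the flux does
    not move: in the layers up to the one being read the switches are open, in
    the next layer all switches are open, hence its current vanishes, and as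
    sigma 0 = 0 all later voltages vanish ([beyond_path_rate]).  Thus every
    window restores all fluxes ([window_restores]), and so does the whole
    procedure ([flux_restored_between_windows]).

    For identifiability, look at the first instant of the window of the
    memristor (l, k, j).  For either initial flux, the flux at that time is
    that initial flux, because the net flux change is 0 and depends only on the
    switches and on the voltage.  Output k therefore carries the current
    W (phi0 k j) * P j, and P j = - h 0 is nonzero: equal currents force equal
    memductances ([memductance_identified]). *)

(** * Integrals of piecewise continuous functions *)

(** Integrability is part of the notion because [Rintegral] is total: without it
    integrals over adjacent intervals would not add up. *)
Definition has_integral (R : realType) (f : R -> R) (a b v : R) : Prop :=
  [/\ a <= b, lebesgue_measure.-integrable `[a, b] (EFin \o f) &
      \int[lebesgue_measure]_(x in `[a, b]) f x = v].

Lemma has_integral_cat (R : realType) (f : R -> R) (a b c u v : R) :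
  has_integral f a b u -> has_integral f b c v -> has_integral f a c (u + v).
Proof.
move=> [ab iu <-] [bc iv <-].
have ac : a <= c by exact: le_trans bc.
have iac : lebesgue_measure.-integrable `[a, c] (EFin \o f).
  have E : `[a, c]%classic = `[a, b] `|` `]b, c] :> set R.
    by rewrite -itv_bndbnd_setU// bnd_simp.
  have iv' : lebesgue_measure.-integrable `]b, c] (EFin \o f).
    by apply: integrableS iv => //; exact: subset_itv_oc_cc.
  case/integrableP: iu => mu fu; case/integrableP: iv' => mv fv.
  have mf := proj2 (measurable_funU _ (measurable_itv _) (measurable_itv _))
    (conj mu mv).
  apply/integrableP; rewrite E; split => //; rewrite ge0_integral_setU//=.
  - exact: lte_add_pinfty.
  - apply/measurable_EFinP; apply: measurableT_comp => //; exact/measurable_EFinP.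
  - apply/disj_setPS => y [/=]; rewrite 2!in_itv/= => /andP[_ yx] /andP[].
    by rewrite ltNge yx.
split => //.
have := @Rintegral_itvB R f (BLeft a) (BRight c) b iac.
rewrite !bnd_simp => /(_ ab bc) /eqP; rewrite subr_eq => /eqP ->.
rewrite addrC Rintegral_itv_obnd_cbnd//.
by apply: integrableS iv => //; exact: subset_itv_oc_cc.
Qed.

(** The fundamental theorem of calculus, for an integrand that agrees with the
    derivative only on the open interval: at the jumps of a piecewise continuous
    signal the value is irrelevant. *)
Lemma primitive_has_integral (R : realType) (F dF f : R -> R) (a b : R) :
  a <= b -> (forall x : R, is_derive x 1 F (dF x)) -> continuous dF ->
  (forall x, a < x < b -> f x = dF x) -> has_integral f a b (F b - F a).
Proof.
move=> + dFP cdF fdF; rewrite le_eqVlt => /predU1P[<-|ab].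
  split=> //; last by rewrite set_itv1 Rintegral_set1 subrr.
  rewrite set_itv1; apply/integrableP; split; first exact: measurable_fun_set1.
  by rewrite integral_set1.
have cF : continuous F.
  by move=> x; apply: differentiable_continuous; apply/derivable1_diffP.
have ci (A : set R) : {within A, continuous dF}.
  exact: continuous_subspaceT.
have iF : lebesgue_measure.-integrable `[a, b] (EFin \o dF).
  by apply: continuous_compact_integrable => //; exact: segment_compact.
have fdF' : {in `]a, b[, f =1 dF} by move=> x; rewrite in_itv/=; exact: fdF.
have mF : measurable_fun `]a, b[ dF.
  by apply: measurable_funTS; exact: continuous_measurable_fun.
have mf : measurable_fun `]a, b[ f.
  apply: eq_measurable_fun mF => x; rewrite inE => /= xab; exact/esym/fdF'.
split; first exact: ltW.
  case/integrableP: iF => _ iF; apply/integrableP; split.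
    apply/measurable_EFinP; exact: measurable_fun_itv_cc mf.
  have := @eq_integral_itv_bounded R a b (fun x => `|dF x|) (fun x => `|f x|)
    true false.
  move=> /= -> //.
  - exact: measurableT_comp.
  - exact: measurableT_comp.
  - by move=> x xab /=; rewrite fdF'.
rewrite /Rintegral (@eq_integral_itv_bounded R a b dF f)//.
rewrite (continuous_FTC2 ab (F := F))//.
- split; first by move=> x _; exact: ex_derive.
  + by apply: cvg_at_right_filter; exact: cF.
  + by apply: cvg_at_left_filter; exact: cF.
- by move=> x _; rewrite derive1E derive_val.
Qed.

Lemma has_integral0 (R : realType) (f : R -> R) (a b : R) :
  a <= b -> (forall x, a < x < b -> f x = 0) -> has_integral f a b 0.
Proof.
move=> ab f0; rewrite -[X in has_integral _ _ _ X](subrr (0 : R)).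
apply: (@primitive_has_integral R (cst 0) (fun=> 0)) => //.
by move=> x; exact: cvg_cst.
Qed.

(** The fundamental theorem differentiates the integral from a fixed left end
    only to the right of that end.  Two such integrals from different left ends
    differ by a constant, so letting the left end depend on the point gives one
    primitive on the whole line. *)
Lemma continuous_primitive (R : realType) (h : R -> R) : continuous h ->
  exists2 G : R -> R, G 0 = 0 & forall x : R, is_derive x 1 G (h x).
Proof.
move=> ch.
have ih a b : lebesgue_measure.-integrable `[a, b] (EFin \o h).
  apply: continuous_compact_integrable; first exact: segment_compact.
  exact: continuous_subspaceT.
pose F a x := \int[lebesgue_measure]_(t in `[a, x]) h t.
have Fcat a b x y : a <= b -> b <= x -> b <= y ->
    F a x - F a y = F b x - F b y.
  have Fsplit u : a <= b -> b <= u -> F a u = F a b + F b u.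
    move=> ab bu; have I c d : c <= d -> has_integral h c d (F c d) by [].
    by case: (has_integral_cat (I _ _ ab) (I _ _ bu)).
  move=> ab bx by_; rewrite (Fsplit x)// (Fsplit y)//.
  by rewrite opprD addrACA subrr add0r.
have Fder (a x : R) : a < x -> is_derive x 1 (F a) (h x).
  move=> ax; have xx : x < x + 1 by rewrite ltrDl.
  have [d dE] := continuous_FTC1_closed xx (ih a _) ax (ch x).
  by apply: DeriveDef => //; rewrite -derive1E.
exists (fun x => F (- `|x| - 1) x - F (- `|x| - 1) 0); first by rewrite subrr.
(* c lies to the left of every left end - `|y| - 1 with y close to x *)
move=> x; pose c := - `|x| - 2.
have cx : c < x by rewrite /c; have := ler_norm (- x); rewrite normrN; lra.
apply: (@near_eq_is_derive _ _ _ (fun y => F c y - F c 0)).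
  near=> y.
  have xy : `|x - y| < 1 by near: y; apply: cvgr_dist_lt.
  have yx : `|y| < `|x| + 1.
    have := lerB_dist y x; rewrite distrC => /le_lt_trans /(_ xy); lra.
  have yy := ler_norm (- y); rewrite normrN in yy.
  have y0 := normr_ge0 y.
  by apply: Fcat; rewrite /c; lra.
rewrite -[h x]subr0; apply: is_deriveB; exact: Fder.
Unshelve. all: by end_near. Qed.

(** * The flux driven by the block signal *)

(** The integral of the block signal from the beginning of its window: the
    triangular wave running through 0, - tau, tau and 0 at the times 0, tau,
    3 * tau and 4 * tau. *)
Definition probe_flux (R : realType) (tau u : R) : R :=
  if u <= tau then - u else if u <= 3 * tau then u - 2 * tau else 4 * tau - u.

Lemma block_signalE (R : realType) (tau u : R) : 0 < tau ->
  0 <= u < 4 * tau ->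
  block_signal tau (u - 4 * tau / 2) =
  if (u < tau) || (3 * tau < u) then -1 else 1.
Proof.
move=> tau0 /andP[u0 u4]; rewrite /block_signal.
case: (ltP _ (- (2 * tau))) => [|_]; first lra.
case: (ltP u tau) => ut /=; first by rewrite ifT //; lra.
rewrite ifF; last by apply/negbTE; rewrite -leNgt; lra.
case: (ltP _ u) => ut'; last by rewrite ifT //; lra.
by rewrite ifF ?ifT //; [lra|apply/negbTE; rewrite -ltNge; lra].
Qed.

(** Substitution in the integral of Q * h(u), where Q is the block signal and u
    its own integral: G(u) is a primitive on each of the three pieces on which
    u is affine, and the increments of G(u) telescope. *)
Lemma probe_integral (R : realType) (tau : R) (h G f : R -> R) (a t : R) :
  0 < tau -> continuous h -> G 0 = 0 -> (forall x : R, is_derive x 1 G (h x)) ->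
  a <= t <= a + 4 * tau ->
  (forall s, a <= s < t ->
     f s = block_signal tau (s - a - 4 * tau / 2) *
           h (probe_flux tau (s - a))) ->
  has_integral f a t (G (probe_flux tau (t - a))).
Proof.
move=> tau0 ch G0 dG /andP[at_ ta] fE.
pose y s := probe_flux tau (s - a).
have ya : y a = 0 by rewrite /y /probe_flux subrr ltW ?oppr0.
have piece (e c u v : R) : a <= u -> u <= v -> v <= t ->
    (forall s, u <= s <= v -> y s = e * s + c) ->
    (forall s, u < s < v -> block_signal tau (s - a - 4 * tau / 2) = e) ->
    has_integral f u v (G (y v) - G (y u)).
  move=> au uv vt yE Qe.
  rewrite !yE ?lexx ?uv//.
  apply: (@primitive_has_integral _ (fun s => G (e * s + c))
    (fun s => e * h (e * s + c))) => //.
  - move=> x; rewrite mulrC.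
    have d : is_derive x 1 (e *: id + cst c) (e *: (1 : R) + 0).
      by apply: is_deriveD; exact: is_deriveZ.
    have E : e *: (1 : R) + 0 = e by rewrite addr0; exact: mulr1.
    rewrite E in d.
    exact: (is_derive1_comp (dG _) d).
  - move=> x; apply: cvgM; first exact: cvg_cst.
    apply: (@continuous_comp _ _ _ (fun s : R => e * s + c) h); last exact: ch.
    by apply: cvgD; [apply: cvgM; [exact: cvg_cst|exact: cvg_id]|exact: cvg_cst].
  - move=> s usv; rewrite fE; last by lra.
    by rewrite Qe// -/(y s) yE//; lra.
have QE s : a <= s < a + 4 * tau ->
    block_signal tau (s - a - 4 * tau / 2) =
    if (s < a + tau) || (a + 3 * tau < s) then -1 else 1.
  by move=> sa; rewrite block_signalE// ?ltrBlDl ?ltrBrDl//; lra.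
have piece1 v : a <= v <= a + tau -> v <= t -> has_integral f a v (G (y v)).
  move=> /andP[av va] vt; rewrite -[G _]subr0 -[X in _ - X]G0 -ya.
  apply: (piece (-1) a) => // s /andP[us sv].
    by rewrite /y /probe_flux ifT; lra.
  by rewrite QE ?ifT//; lra.
have piece2 v : a + tau <= v <= a + 3 * tau -> v <= t ->
    has_integral f a v (G (y v)).
  move=> /andP[av va] vt.
  have := has_integral_cat (piece1 (a + tau) _ _).
  rewrite -[G (y v)](subrKC (G (y (a + tau)))); apply; [lra|lra|].
  apply: (piece 1 (- a - 2 * tau)); [lra|lra|lra| |] => s /andP[us sv].
    rewrite /y /probe_flux; case: leP => ?; first lra.
    by rewrite ifT; lra.
  by rewrite QE ?ifF//; try (apply/negbTE; rewrite negb_or -!leNgt); lra.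
have [t1|t1] := leP t (a + tau); first by apply: piece1 => //; lra.
have [t3|t3] := leP t (a + 3 * tau); first by apply: piece2 => //; lra.
have := has_integral_cat (piece2 (a + 3 * tau) _ _).
rewrite -/(y t) -[G (y t)](subrKC (G (y (a + 3 * tau)))); apply; [lra|lra|].
apply: (piece (-1) (a + 4 * tau)); [lra|lra|lra| |] => s /andP[us sv].
  rewrite /y /probe_flux; case: leP => ?; first lra.
  by case: leP => ?; lra.
by rewrite QE ?ifT//; lra.
Qed.

(** * A single layer *)

Lemma flux_rateE (R : realType) (m p : nat) (S : R -> 'M[bool]_(m, p))
    (P : R -> 'cV[R]_p) (t : R) (a : 'I_m) (b : 'I_p) :
  flux_rate S P t a b = (S t a b)%:R * P t b 0.
Proof.
by rewrite !mxE big_ord_recl big_ord0 !mxE mul1r addr0.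
Qed.

Lemma currentE (R : realType) (m p : nat) (S : R -> 'M[bool]_(m, p))
    (phi0 : 'M[R]_(m, p)) (P : R -> 'cV[R]_p) (W : R -> R) (t : R) (a : 'I_m) :
  current S phi0 P W t a 0 =
  \sum_b W (flux S phi0 P t a b) * (S t a b)%:R * P t b 0.
Proof. by rewrite mxE; apply: eq_bigr => b _; rewrite !mxE. Qed.

Lemma flux_has_integral (R : realType) (m p : nat) (S : R -> 'M[bool]_(m, p))
    (phi0 : 'M[R]_(m, p)) (P : R -> 'cV[R]_p) (t v : R) (a : 'I_m) (b : 'I_p) :
  has_integral (fun s => flux_rate S P s a b) 0 t v ->
  flux S phi0 P t a b = phi0 a b + v.
Proof. by case=> _ _ <-; rewrite mxE. Qed.

Lemma current_single_switch (R : realType) (m p : nat)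
    (S : R -> 'M[bool]_(m, p)) (phi0 : 'M[R]_(m, p)) (P : R -> 'cV[R]_p)
    (W : R -> R) (t : R) (a : 'I_m) (b : 'I_p) :
  (forall b', S t a b' = (b' == b)) ->
  current S phi0 P W t a 0 = W (flux S phi0 P t a b) * P t b 0.
Proof.
move=> SE; rewrite currentE (bigD1 b)//= SE eqxx mulr1 big1 ?addr0// => b' b'b.
by rewrite SE (negbTE b'b) mulr0 mul0r.
Qed.

(** * One reading window *)

Section Window.
Variables (R : realType) (L : nat) (n : nat -> nat) (sigma W : R -> R).
Variables (tau : R) (P0 : R -> 'cV[R]_(n 0%N)).
Variables (S : forall l, R -> 'M[bool]_(n l.+1, n l)).
Variable phi0 : forall l, 'M[R]_(n l.+1, n l).
Hypothesis tau_gt0 : 0 < tau.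
Hypothesis sigma_cont : continuous sigma.
Hypothesis sigma_odd : forall x, sigma (- x) = - sigma x.
Hypothesis sigma_neq0 : forall x, x != 0 -> sigma x != 0.
Hypothesis W_cont : continuous W.
Hypothesis W_gt0 : forall x, 0 < W x.

Let V := voltage sigma W P0 S phi0.

Definition flux_restored (t : R) : Prop := forall i, (i < L)%N ->
  forall (a : 'I_(n i.+1)) (b : 'I_(n i)),
  has_integral (fun s => flux_rate (S i) (V i) s a b) 0 t 0.

Variables (t0 : R) (l : nat) (gamma : nat -> nat).
Hypothesis lL : (l < L)%N.
Hypothesis gammaP : forall i, (i <= l.+1)%N -> (gamma i < n i)%N.
Hypothesis restored : flux_restored t0.
Hypothesis window : forall t, t0 <= t < t0 + 4 * tau ->
  path_switches L l gamma (fun i => S i t) /\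
  (forall b : 'I_(n 0%N), b = gamma 0%N :> nat ->
     P0 t b 0 = block_signal tau (t - t0 - 4 * tau / 2)).

Lemma sigma0 : sigma 0 = 0.
Proof. by have := sigma_odd 0; rewrite oppr0; lra. Qed.

(** Once the voltage of a layer is Q * h(u), its flux is a function of u, and
    the oddness of sigma lets the sign Q pass to the next layer.  The condition
    h 0 != 0 says that the probing voltage reaches every layer of the path. *)
Lemma on_path_voltage i : (i <= l)%N ->
  exists h : R -> R, [/\ continuous h, h 0 != 0 &
    forall t (b : 'I_(n i)), t0 <= t < t0 + 4 * tau -> b = gamma i :> nat ->
      V i t b 0 = block_signal tau (t - t0 - 4 * tau / 2) *
                  h (probe_flux tau (t - t0))].
Proof.
elim: i => [_|i IH il].
  exists (cst 1); split; first by move=> x; exact: cvg_cst.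
    exact: oner_neq0.
  by move=> t b /window[_ P0E] bE; rewrite mulr1 P0E.
have [h [ch h0 hE]] := IH (ltnW il).
have [G G0 dG] := continuous_primitive ch.
pose a := Ordinal (gammaP (leqW il)).
pose b := Ordinal (gammaP (leqW (ltnW il))).
exists (fun x => sigma (W (phi0 i a b + G x) * h x)); split.
- have cG : continuous G.
    by move=> x; apply: differentiable_continuous; apply/derivable1_diffP.
  move=> x; apply: continuous_comp; last exact: sigma_cont.
  apply: cvgM; last exact: ch.
  apply: continuous_comp; last exact: W_cont.
  by apply: cvgD; [exact: cvg_cst|exact: cG].
- by apply: sigma_neq0; rewrite mulf_neq0// gt_eqF.
move=> t a' tw a'E; have -> : a' = a by exact: val_inj.
have SE u : t0 <= u < t0 + 4 * tau -> forall b', S i u a b' = (b' == b).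
  by move=> /window[[+ _] _] b' => ->; rewrite ?eqxx// (ltnW il).
have fluxE : flux (S i) (phi0 i) (V i) t a b =
             phi0 i a b + G (probe_flux tau (t - t0)).
  rewrite -[G _]add0r; apply: flux_has_integral.
  apply: (has_integral_cat (restored (ltn_trans il lL) a b)).
  apply: (probe_integral tau_gt0 ch G0 dG); first by lra.
  move=> s st; rewrite flux_rateE SE ?eqxx ?mul1r ?hE//; lra.
rewrite /V /= mxE -/V (current_single_switch _ _ _ (SE t tw)) fluxE hE//.
rewrite block_signalE//; last by lra.
by case: ifP => _; rewrite ?mul1r// !mulN1r mulrN sigma_odd.
Qed.

(** The open layer right after the path carries no current, so that every later
    layer gets zero voltage whatever its switches are. *)
Lemma beyond_path_rate i : (l < i)%N -> (i < L)%N ->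
  forall t, t0 <= t < t0 + 4 * tau ->
  forall (a : 'I_(n i.+1)) (b : 'I_(n i)), flux_rate (S i) (V i) t a b = 0.
Proof.
move=> + + t tw.
have V0 i' : (l.+1 < i')%N -> (i' <= L)%N -> V i' t = 0.
  elim: i' => // i' IH; rewrite ltnS leq_eqVlt => /predU1P[<-|li'] i'L.
    apply/matrixP => a c; rewrite ord1 [RHS]mxE /V /= mxE currentE big1 ?sigma0// => b _.
    by have [[_ ->]] := window tw; rewrite // !mxE mulr0 mul0r.
  have {}IH := IH li' (ltnW i'L).
  apply/matrixP => a c; rewrite ord1 [RHS]mxE /V /= mxE currentE big1 ?sigma0// => b _.
  by rewrite -/V IH [X in _ * X]mxE mulr0.
rewrite leq_eqVlt => /predU1P[<-|li] iL a b; rewrite flux_rateE.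
  by have [[_ ->]] := window tw; rewrite // mxE mul0r.
by rewrite V0 ?mxE ?mulr0// ltnW.
Qed.

Lemma window_restores : flux_restored (t0 + 4 * tau).
Proof.
move=> i iL a b; rewrite -[X in has_integral _ _ _ X](addr0 (0 : R)).
apply: (has_integral_cat (restored iL a b)).
have le4 : t0 <= t0 + 4 * tau by rewrite lerDl mulr_ge0// ltW.
have [il|li] := leqP i l; last first.
  by apply: has_integral0 => // s st; apply: beyond_path_rate => //; lra.
have [/andP[/eqP aE /eqP bE]|off] :=
    boolP ((a == gamma i.+1 :> nat) && (b == gamma i :> nat)); last first.
  apply: has_integral0 => // s st; rewrite flux_rateE.
  have [|[-> //] _] := @window s; first by lra.
  by rewrite (negbTE off) mul0r.
have [h [ch _ hE]] := on_path_voltage il.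
have [G G0 dG] := continuous_primitive ch.
have -> : 0 = G (probe_flux tau (t0 + 4 * tau - t0)) :> R.
  rewrite -{1}G0; congr G; rewrite /probe_flux.
  by case: leP => ?; [lra|case: leP => ?; lra].
apply: (probe_integral tau_gt0 ch G0 dG); first by lra.
move=> s st; rewrite flux_rateE hE//.
have [[-> //] _] := window st.
by rewrite aE bE !eqxx mul1r.
Qed.

End Window.

(** * The full procedure *)

Lemma size_memristors (L : nat) (n : nat -> nat) :
  size (memristors L n) = (\sum_(0 <= i < L) n i * n i.+1)%N.
Proof.
rewrite size_flatten /shape -map_comp sumnE big_map /index_iota subn0.
by apply: eq_bigr => l _; rewrite /= size_allpairs !size_iota.
Qed.

Lemma mem_memristors (L : nat) (n : nat -> nat) (l k j : nat) :
  ((l, k, j) \in memristors L n) = [&& l < L, k < n l.+1 & j < n l]%N.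
Proof.
apply/flatten_mapP/and3P => [[l' + /allpairsP[[j' k'] /= []]]|[lL kn jn]].
  by rewrite !mem_iota /= !add0n => l'L j'n k'n [-> -> ->].
exists l; rewrite ?mem_iota//.
by apply/allpairsP; exists (j, k); rewrite /= !mem_iota.
Qed.

Section Reading.
Variables (R : realType) (L : nat) (n : nat -> nat) (sigma W : R -> R).
Variables (tau : R) (P0 : R -> 'cV[R]_(n 0%N)).
Variables (S : forall l, R -> 'M[bool]_(n l.+1, n l)).
Variable phi0 : forall l, 'M[R]_(n l.+1, n l).
Hypothesis tau_gt0 : 0 < tau.
Hypothesis sigma_cont : continuous sigma.
Hypothesis sigma_odd : forall x, sigma (- x) = - sigma x.
Hypothesis sigma_neq0 : forall x, x != 0 -> sigma x != 0.
Hypothesis W_cont : continuous W.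
Hypothesis W_gt0 : forall x, 0 < W x.
Hypothesis reading : full_reading_procedure L tau P0 S.

Let T : R := 4 * tau.
Let V := voltage sigma W P0 S phi0.

Let windowS m : m.+1%:R * (4 * tau) = m%:R * T + 4 * tau.
Proof. by rewrite -natr1 [LHS]mulrDl mul1r. Qed.

Lemma reading_window m l k j : onth (memristors L n) m = Some (l, k, j) ->
  exists2 gamma, is_path n l k j gamma &
    forall t, m%:R * T <= t < m%:R * T + 4 * tau ->
      path_switches L l gamma (fun i => S i t) /\
      (forall b : 'I_(n 0%N), b = gamma 0%N :> nat ->
         P0 t b 0 = block_signal tau (t - m%:R * T - 4 * tau / 2)).
Proof.
move=> /reading[gamma path_gamma win]; exists gamma => // t tw.
apply: win; left; rewrite windowS; exact: tw.
Qed.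

Lemma flux_restored_between_windows m : (m <= size (memristors L n))%N ->
  flux_restored L sigma W P0 S phi0 (m%:R * T).
Proof.
elim: m => [_ i iL a b|m IH mN].
  rewrite mul0r; apply: has_integral0 => // x /andP[/lt_trans/[apply]].
  by rewrite ltxx.
have restored := IH (ltnW mN).
have : onth (memristors L n) m by rewrite onthTE.
case E: (onth _ _) => [[[l k] j]|] // _.
have [gamma [gammaP _ _] win] := reading_window E.
have /and3P[lL _ _] : [&& l < L, k < n l.+1 & j < n l]%N.
  by rewrite -mem_memristors; apply/onthP; exists m.
rewrite windowS; exact: (window_restores _ _ _ _ _ _ lL gammaP).
Qed.

(** At the first instant of the window of (l, k, j), output k of layer l sees
    only the memristor (k, j), under a nonzero voltage, and every flux has its
    initial value. *)
Lemma memductance_identified l : (l < L)%N -> forall phi0bar,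
  (forall t, 0 <= t <= (size (memristors L n))%:R * T ->
     current (S l) (phi0 l) (V l) W t = current (S l) phi0bar (V l) W t) ->
  map_mx W (phi0 l) = map_mx W phi0bar.
Proof.
move=> lL phi0bar same; apply/matrixP => k j; rewrite !mxE.
have T_gt0 : 0 < T by rewrite mulr_gt0.
have /onthP[m mE] : (l, k : nat, j : nat) \in memristors L n.
  by rewrite mem_memristors lL !ltn_ord.
have mN : (m < size (memristors L n))%N by rewrite -onthTE mE.
have [gamma [gammaP gj gk] win] := reading_window mE.
have restored := flux_restored_between_windows (ltnW mN).
have tw : m%:R * T <= m%:R * T < m%:R * T + 4 * tau.
  by rewrite lexx ltrDl.
have t_in : 0 <= m%:R * T <= (size (memristors L n))%:R * T.
  by rewrite mulr_ge0 ?ler0n ?(ltW T_gt0)// ler_pM2r// ler_nat ltnW.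
have /matrixP /(_ k 0) := same _ t_in.
have SE b : S l (m%:R * T) k b = (b == j).
  by have [[-> // _] _] := win _ tw; rewrite gj gk eqxx.
rewrite !(current_single_switch _ _ _ SE).
have fluxE phi : flux (S l) phi (V l) (m%:R * T) k j = phi k j.
  by rewrite (flux_has_integral _ (restored l lL k j)) addr0.
rewrite !fluxE; apply: mulIf.
have [h [_ h0 hE]] := on_path_voltage tau_gt0 sigma_cont sigma_odd sigma_neq0
  W_cont W_gt0 lL gammaP restored win (leqnn l).
rewrite hE ?gj// block_signalE ?subrr//; last by rewrite lexx mulr_gt0.
by rewrite tau_gt0 /= /probe_flux ltW// oppr0 mulN1r oppr_eq0.
Qed.

End Reading.

Unset Implicit Arguments.

Theorem corollary1 (R : realType) (L : nat) (n : nat -> nat)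
    (L_gt0 : (0 < L)%N)
    (n_gt0 : forall i : nat, (i <= L)%N -> (0 < n i)%N)
    (sigma : R -> R) (sigmaP : activation_function sigma)
    (g : R -> R) (gP : memristor_characteristic g)
    (tau : R) (tau_gt0 : 0 < tau) :
  let Ttot := 4 * tau * (\sum_(0 <= i < L) n i * n i.+1)%N%:R in
  reading_duration L n tau = Ttot /\
  forall (P0 : R -> 'cV[R]_(n 0%N))
    (S : forall l : nat, R -> 'M[bool]_(n l.+1, n l)),
    full_reading_procedure L tau P0 S ->
    solves_reading_problem L sigma (derive1 g) Ttot P0 S.
Proof.
move=> Ttot.
have TtotE : (size (memristors L n))%:R * (4 * tau) = Ttot.
  by rewrite size_memristors mulrC.
split=> // P0 S reading phi0 l lL P.
case: sigmaP => [[dsigma _] sigma_odd sigma_mono _].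
case: gP => [[_ W_cont] W_gt0 _ _ _].
have sigma_cont : continuous sigma.
  by move=> x; apply: differentiable_continuous; apply/derivable1_diffP.
have sigma_neq0 x : x != 0 -> sigma x != 0.
  move=> x0; have := sigma_mono x 0 x0.
  rewrite subr0 (sigma0 sigma_odd) subr0.
  by apply: contraTneq => ->; rewrite mul0r ltxx.
split=> [phi0bar|].
  rewrite -TtotE; exact: memductance_identified.
apply/matrixP => a b; rewrite -[RHS]addr0; apply: flux_has_integral.
rewrite -TtotE; exact: (flux_restored_between_windows phi0 tau_gt0 sigma_cont
  sigma_odd sigma_neq0 W_cont W_gt0 reading (leqnn _) lL).
Qed.
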